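(* (Hammersley–Clifford.) Let $G=(I,A)$ be a finite graph with set of cliques $\mathcal{C}$, and let $(E_i)_{i\in I}$ be finite sets. For every strictly positive probability law $P_X$ on the finite set $\prod_{i\in I}E_i$, $$P_X\in P(G)\iff P_X\in L(G)\iff P_X\in\mathcal{F}_{\mathcal{C}}.$$
   Context: $G=(I,A)$ is an undirected graph without loops, with vertex set $I$ and edge set $A$; $\partial i$ is the set of vertices adjacent to $i$. A clique of $G$ is a subset of $I$ in which every two distinct vertices are adjacent (so $\emptyset$ and singletons are cliques); $\mathcal{C}$ is the set of all cliques. $E_a=\prod_{i\in a}E_i$ for $a\subseteq I$ ($E_\emptyset$ a one-point set), and $x_a$ is the projection of $x\in E_I$ onto $E_a$. $X=(X_i)_{i\in I}$ is a random variable with law $P_X$, and $X_a=(X_i)_{i\in a}$. For random variables $U,V,W$ with finitely many values and strictly positive joint law, $U\perp V\mid W$ means $P_{(U,V)|W}(u,v,w)=P_{U|W}(u,w)P_{V|W}(v,w)$ for all values $u,v,w$, where $P_{U|W}(u,w)=P_{U,W}(u,w)/P_W(w)$. $P(G)$ (pairwise Markov property) is the set of strictly positive probability laws $P_X$ on $E_I$ such that $X_i\perp X_j\mid X_{I\setminus\{i,j\}}$ for every pair $(i,j)$ of distinct non-adjacent vertices. $L(G)$ (local Markov property) is the set of strictly positive probability laws $P_X$ on $E_I$ such that $X_i\perp X_{I\setminus(\{i\}\cup\partial i)}\mid X_{\partial i}$ for every vertex $i\in I$. For $\mathcal{A}\subseteq\mathcal{P}(I)$ (the power set of $I$), the factorisation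 space $\mathcal{F}_{\mathcal{A}}$ is the set of $f:E_I\to\mathbb{R}_{>0}$ for which there exist $f_a:E_a\to\mathbb{R}_{>0}$, $a\in\mathcal{A}$, with $f(x)=\prod_{a\in\mathcal{A}}f_a(x_a)$ for all $x\in E_I$. *)

(* Defs.v *)
From HB Require Import structures.
From mathcomp Require Import all_boot all_order all_algebra.
From mathcomp Require Import reals.

Set Implicit Arguments.
Unset Strict Implicit.
Unset Printing Implicit Defensive.

Import Order.TTheory GRing.Theory Num.Theory.
Local Open Scope ring_scope.

Section Configurations.
Variables (I : finType) (E : I -> finType).

Definition config : finType := {dffun forall i : I, E i}.

(* [E_a]: for [a = set0] the index type is empty, so this is a one-point set. *)
Definition subconfig (a : {set I}) : finType :=
  {dffun forall i : {i : I | i \in a}, E (val i)}.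

Definition proj (a : {set I}) (x : config) : subconfig a :=
  [ffun i : {i : I | i \in a} => x (val i)].

End Configurations.

Section RandomVariables.
Variables (R : realType) (T : finType).
Implicit Type P : T -> R.

Definition positive_law P : Prop := (forall x, 0 < P x) /\ \sum_x P x = 1.

Definition law_of P (S : finType) (U : T -> S) (u : S) : R :=
  \sum_(x | U x == u) P x.

Definition cond_law P (S S' : finType) (U : T -> S) (W : T -> S')
    (u : S) (w : S') : R :=
  law_of P (fun x => (U x, W x)) (u, w) / law_of P W w.

(* Since [_ / 0 = 0], this is the intended notion only when the joint law of
   [(U, V, W)] is strictly positive. *)
Definition cond_indep P (SU SV SW : finType)
    (U : T -> SU) (V : T -> SV) (W : T -> SW) : Prop :=
  forall u v w,
    cond_law P (fun x => (U x, V x)) W (u, v) w =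
    cond_law P U W u w * cond_law P V W v w.

End RandomVariables.

Section Markov.
Variables (R : realType) (I : finType) (E : I -> finType).

Definition neighbours (e : rel I) (i : I) : {set I} := [set j | e i j].

Definition clique (e : rel I) (a : {set I}) : bool :=
  [forall i in a, forall j in a, (i != j) ==> e i j].

Definition cliques (e : rel I) : {set {set I}} := [set a | clique e a].

(* A law [P] on [config E] is the law of the family of coordinate maps
   [X_i : x |-> x i], for which [X_a] is [proj a]. *)
Definition pairwise_markov (e : rel I) (P : config E -> R) : Prop :=
  positive_law P /\
  forall i j : I, i != j -> ~~ e i j ->
    cond_indep P (fun x : config E => x i) (fun x : config E => x j)
      (@proj I E (~: [set i; j])).

Definition local_markov (e : rel I) (P : config E -> R) : Prop :=
  positive_law P /\
  forall i : I,
    cond_indep P (fun x : config E => x i)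
      (@proj I E (~: (i |: neighbours e i))) (@proj I E (neighbours e i)).

Definition factorisation_space (A : {set {set I}}) (f : config E -> R) : Prop :=
  (forall x, 0 < f x) /\
  exists g : forall a : {set I}, subconfig E a -> R,
    (forall a, a \in A -> forall y, 0 < g a y) /\
    (forall x, f x = \prod_(a in A) g a (proj a x)).

End Markov.

(* Main.v *)
Require Import Defs.
From HB Require Import structures.
From mathcomp Require Import all_boot all_order all_algebra.
From mathcomp Require Import reals.

(** The three properties are compared through one identity without sums. Write
    [splice a x y] for the configuration that agrees with [x] on [a] and with
    [y] elsewhere. In both Markov properties the independence statement is
    about [X_i], a family [X_b] and a conditioning family [X_c] with [{i}], [b]
    and [c] partitioning [I], so that [x] is determined by the three values,
    and independence amounts to the exchange identity
      [P x * P y = P (splice {i} x y) * P (splice {i} y x)]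
    for all [x] and [y] that agree on [c] ([cond_indep_exchangeP]).

    Local implies pairwise: when [j] is not adjacent to [i], configurations
    that agree off [{i, j}] agree on the neighbours of [i].

    Factorisation implies local: it suffices to check the exchange identity for
    each factor [g a]. If [i] is not in [a], splicing at [i] just swaps the two
    arguments of the factor. If [i] is in the clique [a], then [a] is contained
    in [i] and its neighbours, where [x] and [y] differ only at [i], and
    splicing changes nothing.

    Pairwise implies factorisation: fix a reference configuration [o] and show,
    by induction on the size of [a], that [x |-> P (splice a x o)] factorises;
    the theorem is the case where [a] is the whole of [I]. If [a] is a clique
    this function is itself an admissible factor. Otherwise [a] contains two
    distinct non-adjacent vertices [i] and [j], and the exchange identity
    expresses the function for [a] as the product of those for [a :\ i] and
    [a :\ j] divided by that for [a :\ i :\ j]. This replaces the usual Moebius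
    inversion over all subsets of [I]. *)

Set Implicit Arguments.
Unset Strict Implicit.
Unset Printing Implicit Defensive.

Import Order.TTheory GRing.Theory Num.Theory.
Local Open Scope ring_scope.

(** * Conditional independence as an exchange identity *)

Section Exchange.
Variables (R : realType) (T : finType) (P : T -> R).
Variables (SU SV SW : finType) (U : T -> SU) (V : T -> SV) (W : T -> SW).
Variable h : T -> T -> T.
Hypothesis P_gt0 : forall x, 0 < P x.
Hypothesis UVW_inj : forall x y, U x = U y -> V x = V y -> W x = W y -> x = y.
Hypothesis Uh : forall x y, U (h x y) = U x.
Hypothesis Vh : forall x y, V (h x y) = V y.
Hypothesis Wh : forall x y, W (h x y) = W y.

Let joint_law x : law_of P (fun z => (U z, V z, W z)) (U x, V x, W x) = P x.
Proof.
rewrite /law_of (big_pred1 x) // => z /=.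
apply/eqP/eqP => [[eU eV eW]|-> //]; exact: UVW_inj.
Qed.

Let law_neq0 x : law_of P W (W x) != 0.
Proof.
rewrite /law_of (bigD1 x) //= gt_eqF // ltr_wpDr //.
by apply: sumr_ge0 => z _; apply: ltW.
Qed.

(** The pairs [(x, y)] with prescribed [(U, W)] and [(V, W)] values correspond
    to the single points [h y x] with the prescribed value of [W], and the
    exchange identity makes this correspondence preserve weights up to the
    constant factor [P x0]. *)
Lemma exchange_law_mul x0 :
  (forall x y, W x = W y -> P x * P y = P (h x y) * P (h y x)) ->
  law_of P (fun z => (U z, W z)) (U x0, W x0) *
  law_of P (fun z => (V z, W z)) (V x0, W x0) = P x0 * law_of P W (W x0).
Proof.
move=> exch; rewrite /law_of big_distrlr /= pair_big_dep /=.
rewrite (reindex_onto (fun z => (h x0 z, h z x0)) (fun p => h p.2 p.1)) /=;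
  last first.
  move=> [x y] /= /andP[/eqP[Ux Wx] /eqP[Vy Wy]].
  by congr (_, _); apply: UVW_inj; rewrite !(Uh, Vh, Wh).
rewrite mulr_sumr; apply: eq_big => [z|z].
  rewrite !xpair_eqE !Uh !Vh !Wh !eqxx /=.
  apply/andP/eqP => [[/andP[/eqP -> //]]|Wz].
  by rewrite Wz eqxx; split=> //; apply/eqP/UVW_inj; rewrite !(Uh, Vh, Wh).
by rewrite !xpair_eqE !Wh => /andP[/andP[/andP[_ /eqP Wz] _] _]; rewrite -exch.
Qed.

(** When [(U, V, W)] determines the sample point, conditional independence says
    that [P] is a function of [(U, W)] times a function of [(V, W)], that is,
    that exchanging the [U]-values of two points with the same [W] preserves
    the product of their weights. The function [h] produces the exchanged
    points: [h x y] is [y] with its [U]-value replaced by that of [x]. *)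
Lemma cond_indep_exchangeP :
  cond_indep P U V W <->
  (forall x y, W x = W y -> P x * P y = P (h x y) * P (h y x)).
Proof.
split=> [ci x y Wxy | exch u v w].
  have P_E z : P z = law_of P W (W z) *
      (cond_law P U W (U z) (W z) * cond_law P V W (V z) (W z)).
    by rewrite -ci /cond_law joint_law mulrC divfK.
  rewrite (P_E x) (P_E y) (P_E (h x y)) (P_E (h y x)) !Uh !Vh !Wh Wxy.
  by rewrite mulrACA [RHS]mulrACA; congr (_ * _);
     rewrite mulrACA [RHS]mulrACA [in RHS](mulrC (cond_law P V W _ _)).
rewrite /cond_law.
have [/existsP[x0 /eqP[<- <- <-]]|unattained] :=
    boolP [exists x, (U x, V x, W x) == (u, v, w)].
  rewrite joint_law mulf_div exchange_law_mul //.
  by rewrite invfM mulrA mulfK.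
(* Both sides vanish: points attaining [(u, w)] and [(v, w)] would be combined
   by [h] into a point attaining [(u, v, w)]. *)
rewrite {1}/law_of big_pred0 ?mul0r; last first.
  by move=> x; apply: contraNF unattained => ?; apply/existsP; exists x.
have [/existsP[x /eqP[Ux Wx]]|noU] := boolP [exists x, (U x, W x) == (u, w)].
  rewrite [X in _ = _ * (X / _)]/law_of big_pred0 ?mul0r ?mulr0 // => y.
  apply: contraNF unattained => /eqP[Vy Wy]; apply/existsP; exists (h x y).
  by rewrite Uh Vh Wh Ux Vy Wy.
rewrite [X in _ = X / _ * _]/law_of big_pred0 ?mul0r // => x.
by apply: contraNF noU => ?; apply/existsP; exists x.
Qed.

End Exchange.

(** * Splicing configurations *)

Section Splice.
Variables (I : finType) (E : I -> finType).
Implicit Types (x y z : config E) (a b : {set I}).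

Definition splice a x y : config E := [ffun k => if k \in a then x k else y k].

Lemma spliceE a x y k : splice a x y k = if k \in a then x k else y k.
Proof. by rewrite ffunE. Qed.

Lemma eq_projP a x y : proj a x = proj a y <-> (forall k, k \in a -> x k = y k).
Proof.
split=> [eq_xy k ka | eq_xy]; last first.
  by apply/ffunP => k; rewrite !ffunE eq_xy ?(valP k).
by move/ffunP/(_ (exist _ k ka)): eq_xy; rewrite !ffunE.
Qed.

Lemma cond_indep_coordP (R : realType) (P : config E -> R) (i : I) (b c : {set I}) :
  (forall x, 0 < P x) -> i \notin b -> i \notin c -> i |: (b :|: c) = setT ->
  cond_indep P (fun x : config E => x i) (@proj I E b) (@proj I E c) <->
  (forall x y, proj c x = proj c y ->
     P x * P y = P (splice [set i] x y) * P (splice [set i] y x)).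
Proof.
move=> P_gt0 ib ic cov; apply: cond_indep_exchangeP => // [x y xi|x y|x y|x y].
- move=> /eq_projP xb /eq_projP xc; apply/ffunP => k.
  have: k \in i |: (b :|: c) by rewrite cov inE.
  by rewrite !inE => /orP[/eqP->|/orP[/xb|/xc]].
- by rewrite spliceE set11.
- by apply/eq_projP => k kb; rewrite spliceE inE; case: eqP ib => // <-; rewrite kb.
- by apply/eq_projP => k kc; rewrite spliceE inE; case: eqP ic => // <-; rewrite kc.
Qed.

End Splice.

(** * Closure properties of factorisation spaces *)

Section Factorisation.
Variables (R : realType) (I : finType) (E : I -> finType) (A : {set {set I}}).
Implicit Types f : config E -> R.

Lemma factorisation_space_mul f1 f2 :
  factorisation_space A f1 -> factorisation_space A f2 ->
  factorisation_space A (fun x => f1 x * f2 x).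
Proof.
move=> [f1_gt0 [g1 [g1_gt0 f1E]]] [f2_gt0 [g2 [g2_gt0 f2E]]].
split=> [x|]; first exact: mulr_gt0.
exists (fun a y => g1 a y * g2 a y); split=> [a aA y|x].
  by rewrite mulr_gt0 ?g1_gt0 ?g2_gt0.
by rewrite f1E f2E big_split.
Qed.

Lemma factorisation_space_inv f :
  factorisation_space A f -> factorisation_space A (fun x => (f x)^-1).
Proof.
move=> [f_gt0 [g [g_gt0 fE]]]; split=> [x|]; first by rewrite invr_gt0.
exists (fun a y => (g a y)^-1); split=> [a aA y|x]; first by rewrite invr_gt0 g_gt0.
by rewrite fE prodfV.
Qed.

Lemma factorisation_space_ext f1 f2 :
  f1 =1 f2 -> factorisation_space A f1 -> factorisation_space A f2.
Proof.
move=> f12 [f_gt0 [g [g_gt0 fE]]]; split=> [x|]; first by rewrite -f12.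
by exists g; split=> // x; rewrite -f12.
Qed.

Lemma factorisation_space_single f a :
  a \in A -> (forall x, 0 < f x) ->
  (forall x y, proj a x = proj a y -> f x = f y) -> factorisation_space A f.
Proof.
move=> aA f_gt0 f_proj; split=> //.
(* The factor at [a] evaluates [f] at any configuration above its argument;
   the inner default 1 is taken only at arguments that no configuration
   projects to. *)
exists (fun b y => if b == a then
          if [pick z | proj b z == y] is Some z then f z else 1 else 1).
split=> [b _ y|x]; first by case: (b == a) => //; case: pickP.
rewrite (bigD1 a) //= eqxx big1 ?mulr1; last by move=> b /andP[_ /negbTE->].
by case: pickP => [z /eqP/f_proj -> //|/(_ x)]; rewrite eqxx.
Qed.

End Factorisation.

(** * Markov properties and clique factorisations *)

Section MarkovFields.
Variables (R : realType) (I : finType) (e : rel I) (E : I -> finType).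
Hypothesis e_irr : irreflexive e.
Variable P : config E -> R.
Hypothesis P_law : positive_law P.

Let P_gt0 x : 0 < P x. Proof. by case: P_law. Qed.

Lemma local_markovP :
  local_markov e P <->
  (forall i x y, proj (neighbours e i) x = proj (neighbours e i) y ->
     P x * P y = P (splice [set i] x y) * P (splice [set i] y x)).
Proof.
have lm i : cond_indep P (fun x : config E => x i)
    (@proj I E (~: (i |: neighbours e i))) (@proj I E (neighbours e i)) <->
  (forall x y, proj (neighbours e i) x = proj (neighbours e i) y ->
     P x * P y = P (splice [set i] x y) * P (splice [set i] y x)).
  apply: cond_indep_coordP; rewrite ?inE ?eqxx ?e_irr //.
  by apply/setP => k; rewrite !inE; case: (k == i); case: (e i k).
split=> [[_ ci] i|exch]; first exact/lm/ci.
by split=> // i; apply/lm/exch.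
Qed.

Lemma pairwise_markovP :
  pairwise_markov e P <->
  (forall i j, i != j -> ~~ e i j ->
   forall x y, proj (~: [set i; j]) x = proj (~: [set i; j]) y ->
     P x * P y = P (splice [set i] x y) * P (splice [set i] y x)).
Proof.
(* The variable on the second side is [X_j] itself, whereas the coordinate
   criterion is stated for a family [X_b]. *)
have pm i j : i != j -> cond_indep P (fun x : config E => x i)
      (fun x : config E => x j) (@proj I E (~: [set i; j])) <->
  (forall x y, proj (~: [set i; j]) x = proj (~: [set i; j]) y ->
     P x * P y = P (splice [set i] x y) * P (splice [set i] y x)).
  move=> ij; apply: cond_indep_exchangeP => // [x y xi xj /eq_projP xc|x y|x y|x y].
  - apply/ffunP => k; have [->//|ki] := eqVneq k i; have [->//|kj] := eqVneq k j.
    by apply: xc; rewrite !inE negb_or ki.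
  - by rewrite spliceE set11.
  - by rewrite spliceE inE eq_sym (negbTE ij).
  - by apply/eq_projP => k; rewrite spliceE !inE negb_or => /andP[/negbTE->].
split=> [[_ ci] i j ij nij|exch]; first exact/pm/ci.
by split=> // i j ij nij; apply/pm/exch.
Qed.

Lemma local_pairwise_markov : local_markov e P -> pairwise_markov e P.
Proof.
move=> /local_markovP exch; apply/pairwise_markovP => i j ij nij x y /eq_projP xy.
apply: exch; apply/eq_projP => k; rewrite inE => eik; apply: xy; rewrite !inE.
by apply: contraL eik => /orP[]/eqP->; rewrite ?e_irr.
Qed.

Lemma factorisation_local_markov :
  factorisation_space (cliques e) P -> local_markov e P.
Proof.
move=> [_ [g [_ PE]]]; apply/local_markovP => i x y /eq_projP xy.
rewrite !PE -!big_split; apply: eq_bigr => a; rewrite inE => /forall_inP cl_a /=.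
have [ia|nia] := boolP (i \in a).
  have xy_a k : k \in a -> k != i -> x k = y k.
    move=> ka ki; apply: xy; rewrite inE.
    by move/forall_inP/(_ _ ka)/implyP: (cl_a i ia); apply; rewrite eq_sym.
  by congr (g a _ * g a _); apply/eq_projP => k ka; rewrite spliceE inE;
     case: eqVneq => // ki; rewrite xy_a.
by rewrite mulrC; congr (g a _ * g a _); apply/eq_projP => k ka;
   rewrite spliceE inE; case: eqVneq => // ki; rewrite -ki ka in nia.
Qed.

(** The exchange identity at the configurations [splice a x o] and
    [splice (a :\ i :\ j) x o], which differ only at [i] and [j]. *)
Lemma pairwise_splice_mul (o x : config E) (a : {set I}) i j :
  pairwise_markov e P -> i \in a -> j \in a -> i != j -> ~~ e i j ->
  P (splice a x o) * P (splice (a :\ i :\ j) x o) =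
  P (splice (a :\ i) x o) * P (splice (a :\ j) x o).
Proof.
move=> /pairwise_markovP exch ia ja ij nij.
rewrite (exch i j ij nij); last first.
  apply/eq_projP => k; rewrite !inE negb_or !spliceE !inE => /andP[ki kj].
  by rewrite ki kj.
rewrite mulrC; congr (P _ * P _); apply/ffunP => k; rewrite !spliceE !inE.
  have [->|ki] := eqVneq k i; first by rewrite /= andbF.
  by [].
have [->|ki] := eqVneq k i; first by rewrite ij.
by [].
Qed.

Lemma pairwise_splice_factorisation (o : config E) (a : {set I}) :
  pairwise_markov e P ->
  factorisation_space (cliques e) (fun x => P (splice a x o)).
Proof.
move=> pm; have [n] := ubnP #|a|; elim: n a => // n IHn a le_a.
have [cl_a|] := boolP (clique e a).
  apply: (factorisation_space_single (a := a)); rewrite ?inE // => x y /eq_projP xy.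
  by congr P; apply/ffunP => k; rewrite !spliceE; case: ifP => // /xy.
case/forall_inPn=> i ia /forall_inPn[j ja]; rewrite negb_imply => /andP[ij nij].
have IHsub (b : {set I}) : b \proper a ->
    factorisation_space (cliques e) (fun x => P (splice b x o)).
  by move=> /proper_card lt_ba; apply: IHn; apply: leq_trans lt_ba _.
have pi := properD1 ia; have pj := properD1 ja.
have pij : a :\ i :\ j \proper a by apply: sub_proper_trans pi; apply: subD1set.
apply: factorisation_space_ext (factorisation_space_mul
  (factorisation_space_mul (IHsub _ pi) (IHsub _ pj))
  (factorisation_space_inv (IHsub _ pij))) => x /=.
by rewrite -(pairwise_splice_mul o x pm ia ja ij nij) mulfK // gt_eqF.
Qed.

Lemma pairwise_markov_factorisation :
  pairwise_markov e P -> factorisation_space (cliques e) P.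
Proof.
move=> pm.
(* Total mass 1 guarantees that a reference configuration exists. *)
have [o _|no_config] := pickP (@predT (config E)); last first.
  by case: P_law => _; rewrite big_pred0 // => /eqP; rewrite eq_sym oner_eq0.
apply: factorisation_space_ext (pairwise_splice_factorisation o setT pm) => x.
by congr P; apply/ffunP => k; rewrite spliceE inE.
Qed.

End MarkovFields.

Theorem theorem1p2 (R : realType) (I : finType) (e : rel I)
    (e_sym : symmetric e) (e_irr : irreflexive e)
    (E : I -> finType) (P : config E -> R) (P_law : positive_law P) :
  (pairwise_markov e P <-> local_markov e P) /\
  (local_markov e P <-> factorisation_space (cliques e) P).
Proof.
have L_P := local_pairwise_markov e_irr P_law.
have P_F := pairwise_markov_factorisation (e := e) P_law.
have F_L := factorisation_local_markov e_irr P_law.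
by split; split=> [?|?]; auto.
Qed.
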